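(* Let $\mathfrak{R}$ be an elementary divisor domain that is not a field, and $\mathbb{F}$ its field of fractions. Let $A\in\mathbb{F}^{n\times n}$, $B\in\mathbb{F}^{n\times m}$ and $C\in\mathbb{F}^{p\times n}$ be matrices such that $\det A\neq 0$, $A$ and $B$ are left coprime in $\mathfrak{R}$ and $A$ and $C$ are right coprime in $\mathfrak{R}$. Let $\alpha$, $\beta$ and $\gamma$ be least common denominators in $\mathfrak{R}$ of $A$, $B$ and $C$, respectively. Let $D\in\mathbb{F}^{p\times m}$ be a matrix such that $\frac{\beta\gamma}{\alpha}D\in\mathfrak{R}^{p\times m}$. Let $G=D-CA^{-1}B\in\mathbb{F}^{p\times m}$ and let $$S_G \doteq \operatorname{Diag}\left(\frac{\varepsilon_1}{\psi_1},\ldots, \frac{\varepsilon_r}{\psi_r}\right) \oplus 0_{(p-r) \times (m-r)}$$ be its Smith-McMillan form. For $i=1,\ldots,r$ define $$\delta_i=\gcd(\varepsilon_i,\alpha), \quad \widehat\alpha_i=\frac{\alpha}{\delta_i}, \quad \widetilde\varepsilon_i=\frac{\varepsilon_i}{\delta_i},$$ $$\nu_i=\gcd(\psi_i,\beta\gamma),\quad \widehat\beta_i=\frac{\beta\gamma}{\nu_i},\quad \widetilde{\psi}_i=\frac{\psi_i}{\nu_i},$$ $$\chi_i=\gcd(\widehat\alpha_i,\widehat\beta_i),\quad \widetilde\alpha_i=\frac{\widehat\alpha_i}{\chi_i},\quad \widetilde\beta_i=\frac{\widehat\beta_i}{\chi_i},$$ and let $g$ be the largest index in $\{1,\ldots,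 r\}$ such that $\widetilde\alpha_g\widetilde\psi_g\notin\mathfrak{R}^\times$ (with $g=0$ if there is none). Then (i) the Smith-McMillan form of $A$ is $S_A \doteq \frac{1}{\alpha}I_{n-g} \oplus \operatorname{Diag}\left( \frac{\widetilde{\psi}_g}{\delta_g\chi_g},\ldots, \frac{\widetilde\psi_1}{\delta_1\chi_1} \right) \in \mathbb{F}^{n\times n}$, and (ii) the Smith-McMillan form of $$P=\frac{1}{\beta\gamma}\begin{bmatrix} \alpha A & \beta B\\ \gamma C & \frac{\beta\gamma}{\alpha} D\end{bmatrix}\in \mathbb{F}^{(n+p)\times (n+m)}$$ is $S_P\doteq\frac{1}{\beta\gamma}I_n \oplus \operatorname{Diag}\left(\frac{\widetilde\varepsilon_1}{\nu_1\chi_1},\ldots,\frac{\widetilde\varepsilon_r}{\nu_r\chi_r} \right) \oplus 0_{(p-r) \times (m-r)}$.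
   Context: An elementary divisor domain (EDD) is an integral domain $\mathfrak{R}$ such that every $a,b,c\in\mathfrak{R}$ have a greatest common divisor which can be written $\gcd(a,b,c)=zxa+zyb+wyc$ for some $x,y,z,w\in\mathfrak{R}$; equivalently, an integral domain over which every matrix $M$ is equivalent to one of the form $\operatorname{Diag}(\alpha_1,\dots,\alpha_r)\oplus 0$ with nonzero $\alpha_1\mid\cdots\mid\alpha_r$. $\mathfrak{R}^\times$ is the group of units. A square matrix over $\mathfrak{R}$ is unimodular if it is invertible over $\mathfrak{R}$. Two matrices $M,N$ of the same size over $\mathbb{F}$ are equivalent if $UMV=N$ with $U,V$ unimodular over $\mathfrak{R}$. Smith-McMillan form of $G\in\mathbb{F}^{p\times m}$ of rank $r$: a matrix $\operatorname{Diag}(\varepsilon_1/\psi_1,\dots,\varepsilon_r/\psi_r)\oplus 0_{(p-r)\times(m-r)}$ equivalent to $G$, with nonzero $\varepsilon_i,\psi_i\in\mathfrak{R}$, $\varepsilon_1\mid\cdots\mid\varepsilon_r$, $\psi_r\mid\cdots\mid\psi_1$ and $\gcd(\varepsilon_i,\psi_i)\doteq 1$ (unique up to units). The symbol $\doteq$ means equality up to multiplication by a unit of $\mathfrak{R}$ (for scalars) or by a diagonal unimodular matrix (for matrices); gcds and ''the'' Smith-McMillan form are understood up to $\doteq$. (The displayed forms in the conclusion are to be read with these numerators and denominators, i.e. they satisfy the divisibility chains and coprimeness conditions.) A least common denominator in $\mathfrak{R}$ of a matrix $H$ over $\mathbb{F}$ is a least common denominator of its entries: a nonzero $\tau\in\mathfrak{R}$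 with $\tau H$ over $\mathfrak{R}$ that divides every nonzero $\tau'\in\mathfrak{R}$ with $\tau'H$ over $\mathfrak{R}$. Coprimeness over $\mathfrak{R}$: $G_1\in\mathfrak{R}^{p\times m}$ and $G_2\in\mathfrak{R}^{q\times m}$ are right coprime if every $F\in\mathfrak{R}^{m\times m}$ with $G_1=\widetilde G_1F$, $G_2=\widetilde G_2F$ for some matrices $\widetilde G_1,\widetilde G_2$ over $\mathfrak{R}$ is unimodular; $H_1,H_2$ (same number of rows) are left coprime if $H_1^T,H_2^T$ are right coprime. Coprimeness over $\mathbb{F}$: matrices $T_1,T_2$ over $\mathbb{F}$ with least common denominators $\tau_1,\tau_2$ in $\mathfrak{R}$ are right (resp. left) coprime in $\mathfrak{R}$ if $\tau_1T_1$ and $\tau_2T_2$ are right (resp. left) coprime over $\mathfrak{R}$. $\oplus$ denotes the block diagonal sum; $0_{0\times q}$ (resp. $0_{p\times 0}$) in a direct sum means appending $q$ zero columns (resp. $p$ zero rows). *)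

(* Defs.v *)
From mathcomp Require Import all_boot all_order all_algebra.
Set Implicit Arguments.
Unset Strict Implicit.
Unset Printing Implicit Defensive.
Import GRing.Theory.
Local Open Scope ring_scope.

Section EDD.
Variable R : idomainType.
Local Notation F := {fraction R}.

Definition divides (a b : R) : Prop := exists c, b = a * c.

(* gcds in R are only unique up to units, hence a relation. *)
Definition is_gcd (d a b : R) : Prop :=
  [/\ divides d a, divides d b &
      forall e, divides e a -> divides e b -> divides e d].

Definition is_gcd3 (d a b c : R) : Prop :=
  [/\ divides d a, divides d b, divides d c &
      forall e, divides e a -> divides e b -> divides e c -> divides e d].

Definition elementary_divisor_domain : Prop :=
  forall a b c : R, exists x y z w : R,
    is_gcd3 (z * x * a + z * y * b + w * y * c) a b c.

Definition not_a_field : Prop :=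
  exists x : R, x != 0 /\ x \isn't a GRing.unit.

Definition mxfrac p m (M : 'M[R]_(p, m)) : 'M[F]_(p, m) := map_mx (@tofrac R) M.

Definition mx_integral p m (H : 'M[F]_(p, m)) : Prop :=
  exists M : 'M[R]_(p, m), H = mxfrac M.

Definition is_lcd (t : R) p m (H : 'M[F]_(p, m)) : Prop :=
  [/\ t != 0, mx_integral (tofrac t *: H) &
      forall t', t' != 0 -> mx_integral (tofrac t' *: H) -> divides t t'].

Definition mx_equiv p m (M N : 'M[F]_(p, m)) : Prop :=
  exists (U : 'M[R]_p) (V : 'M[R]_m),
    [/\ U \in unitmx, V \in unitmx & mxfrac U *m M *m mxfrac V = N].

(* When size s <= p and size s <= m this is Diag(s) (+) 0, since s`_i = 0
   for i >= size s. *)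
Definition diag_oplus0 p m (s : seq F) : 'M[F]_(p, m) :=
  \matrix_(i, j) (s`_i *+ (i == j :> nat)).

(* The Smith-McMillan form of G is
   Diag(e_1/psi_1, ..., e_r/psi_r) (+) 0, where
   s = [:: (e_1, psi_1); ...; (e_r, psi_r)].  The form being defined up to
   units, this is a relation.  Since size s = \rank G, the size of s is at most
   p and m. *)
Definition smith_mcmillan p m (G : 'M[F]_(p, m)) (s : seq (R * R)) : Prop :=
  let e i := (nth (0, 1) s i).1 in
  let psi i := (nth (0, 1) s i).2 in
  [/\ size s = \rank G,
      mx_equiv G (diag_oplus0 p m [seq tofrac x.1 / tofrac x.2 | x <- s]),
      forall i, (i < size s)%N ->
        [/\ e i != 0, psi i != 0 & is_gcd 1 (e i) (psi i)],
      forall i, (i.+1 < size s)%N -> divides (e i) (e i.+1) &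
      forall i, (i.+1 < size s)%N -> divides (psi i.+1) (psi i)].

Definition right_coprime p q m (G1 : 'M[R]_(p, m)) (G2 : 'M[R]_(q, m)) : Prop :=
  forall (K : 'M[R]_m) (H1 : 'M[R]_(p, m)) (H2 : 'M[R]_(q, m)),
    G1 = H1 *m K -> G2 = H2 *m K -> K \in unitmx.

Definition left_coprime p q n (G1 : 'M[R]_(n, p)) (G2 : 'M[R]_(n, q)) : Prop :=
  right_coprime G1^T G2^T.

Definition frac_right_coprime p q m (T1 : 'M[F]_(p, m)) (T2 : 'M[F]_(q, m)) :
    Prop :=
  exists (t1 t2 : R) (G1 : 'M[R]_(p, m)) (G2 : 'M[R]_(q, m)),
    [/\ is_lcd t1 T1, is_lcd t2 T2, tofrac t1 *: T1 = mxfrac G1,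
        tofrac t2 *: T2 = mxfrac G2 & right_coprime G1 G2].

Definition frac_left_coprime p q n (T1 : 'M[F]_(n, p)) (T2 : 'M[F]_(n, q)) :
    Prop :=
  exists (t1 t2 : R) (G1 : 'M[R]_(n, p)) (G2 : 'M[R]_(n, q)),
    [/\ is_lcd t1 T1, is_lcd t2 T2, tofrac t1 *: T1 = mxfrac G1,
        tofrac t2 *: T2 = mxfrac G2 & left_coprime G1 G2].

End EDD.

Arguments elementary_divisor_domain : clear implicits.
Arguments not_a_field : clear implicits.

(* Main.v *)
Require Import Defs.
From mathcomp Require Import all_boot all_order all_fingroup all_algebra.
From mathcomp Require Import ring zify.
Import GRing.Theory.
Local Open Scope ring_scope.
Set Implicit Arguments.
Unset Strict Implicit.
Unset Printing Implicit Defensive.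

(** Put [a = alpha A], [b = beta B], [c = gamma C], [d = (beta gamma / alpha) D],
    all of them over [R].  The Schur complement [d - c a^-1 b] is
    [(beta gamma / alpha) G]; the successive gcds of the statement reduce the
    diagonal entries of its Smith-McMillan form to
    [(betat_i epst_i) / (alphat_i psit_i)], so that up to unimodular factors it is
    [E Psi^-1] with [E] and [Psi] diagonal and coprime.  Bezout identities for
    [(a, b)] and [(a, c)] turn [c a^-1 b Psi = d Psi - E] into [b Psi = a Q] and
    [d Psi = c Q + E] for some [Q] over [R], and [[a b]], [[-Q; Psi]] are parts
    of mutually inverse matrices.  Hence [I (+) a ~ Psi (+) I] and
    [[a b; c d] ~ I (+) E]; existence and uniqueness of the Smith form over [R]
    allow one to cancel the identity blocks in the former. *)

(** * Divisibility, comaximality and Bezout identities in [R] *)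

Section Divisibility.
Variable R : idomainType.
Implicit Types a b c d x y : R.

Lemma divides_refl a : divides a a.
Proof. by exists 1; rewrite mulr1. Qed.

Lemma divides1 a : divides 1 a.
Proof. by exists a; rewrite mul1r. Qed.

Lemma divides0 a : divides a 0.
Proof. by exists 0; rewrite mulr0. Qed.

Lemma divides_trans b a c : divides a b -> divides b c -> divides a c.
Proof. by move=> [x ->] [y ->]; exists (x * y); rewrite mulrA. Qed.

Lemma divides_mull a b c : divides a b -> divides a (c * b).
Proof. by move=> [x ->]; exists (c * x); rewrite mulrCA. Qed.

Lemma divides_mulr a b c : divides a b -> divides a (b * c).
Proof. by rewrite mulrC; apply: divides_mull. Qed.

Lemma divides_mul a b c d :
  divides a b -> divides c d -> divides (a * c) (b * d).
Proof. by move=> [x ->] [y ->]; exists (x * y); rewrite mulrACA. Qed.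

Lemma divides_sum (I : finType) (F : I -> R) a :
  (forall i, divides a (F i)) -> divides a (\sum_i F i).
Proof.
move=> aF; elim/big_ind: _ => // [|_ _ [x ->] [y ->]]; first exact: divides0.
by exists (x + y); rewrite mulrDr.
Qed.

Lemma divides_unit a b : divides a b -> b \is a GRing.unit -> a \is a GRing.unit.
Proof. by move=> [x ->]; rewrite unitrM => /andP[]. Qed.

Lemma unit_divides a b : a \is a GRing.unit -> divides a b.
Proof. by move=> ua; exists (a^-1 * b); rewrite mulVKr. Qed.

Lemma divides_chain (f : nat -> R) :
  (forall i, divides (f i) (f i.+1)) -> {homo f : i j / (i <= j)%N >-> divides i j}.
Proof.
move=> fS i; elim=> [|j IHj]; first by rewrite leqn0 => /eqP->; apply: divides_refl.
rewrite leq_eqVlt => /predU1P[->|]; first exact: divides_refl.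
by rewrite ltnS => /IHj fij; apply: divides_trans fij (fS j).
Qed.

Lemma divides_assoc a b : divides a b -> divides b a ->
  exists2 u, u \is a GRing.unit & b = a * u.
Proof.
move=> [u eb] [v ea]; have [a0|a_neq0] := eqVneq a 0.
  by exists 1; rewrite ?unitr1 // eb a0 !mul0r.
exists u => //; apply/unitrP; exists v.
have /(mulfI a_neq0) uv1 : a * (u * v) = a * 1 by rewrite mulrA -eb -ea mulr1.
by rewrite mulrC uv1.
Qed.

(** The Bezout form of coprimeness, stable under products and under passing to divisors by direct
    computation. Over an elementary divisor domain it follows from [is_gcd 1]. *)
Definition comaximal a b := exists x y, x * a + y * b = 1.

Lemma comaximal_sym a b : comaximal a b -> comaximal b a.
Proof. by move=> [x [y e]]; exists y, x; rewrite addrC. Qed.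

Lemma comaximal1 a : comaximal 1 a.
Proof. by exists 1, 0; rewrite mul0r addr0 mulr1. Qed.

Lemma comaximal_dvd a b a' b' :
  divides a' a -> divides b' b -> comaximal a b -> comaximal a' b'.
Proof.
by move=> [c ->] [d ->] [x [y e]]; exists (x * c), (y * d); rewrite -e; ring.
Qed.

Lemma comaximalM a b c : comaximal a b -> comaximal a c -> comaximal a (b * c).
Proof.
(* The coefficients are read off from the product of the two given identities. *)
move=> [x [y e]] [x' [y' e']]; exists (x * (x' * a + y' * c) + y * b * x'), (y * y').
by rewrite -[RHS]mulr1 -{1}e -{1}e'; ring.
Qed.

Lemma comaximal_is_gcd a b : comaximal a b -> is_gcd 1 a b.
Proof.
move=> [x [y e]]; split; [exact: divides1 | exact: divides1 |].
by move=> d [a' ea] [b' eb]; exists (x * a' + y * b'); rewrite -e ea eb; ring.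
Qed.

Lemma Gauss_divides a b c : comaximal a b -> divides a (b * c) -> divides a c.
Proof.
move=> [x [y e]] [k ek]; exists (x * c + y * k).
by rewrite mulrDr (mulrCA a y) -ek -[LHS]mul1r -e; ring.
Qed.

(* In other words, if [x1 / y1] and [x2 / y2] are reduced fractions whose
   quotient is [c]. *)
Lemma reduced_fraction_dvd c x1 y1 x2 y2 :
  comaximal x1 y1 -> comaximal x2 y2 -> x2 * y1 = c * (x1 * y2) ->
  divides x1 x2 /\ divides y2 y1.
Proof.
move=> cop1 cop2 e; split.
  apply: (Gauss_divides (b := y1)) => //.
  by exists (c * y2); rewrite mulrC e; ring.
apply: (Gauss_divides (b := x2)); first exact: comaximal_sym.
by exists (c * x1); rewrite e; ring.
Qed.

Hypothesis hEDD : elementary_divisor_domain R.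

(** The defining property at [c = 0] makes [R] a Bezout domain. The cofactors [a'] and [b'] belong
    to the conclusion because [a] and [b] do not determine them when [d = 0]; they are then set to 1
    and 0 to keep the last identity true. *)
Lemma EDD_gcd a b : exists d a' b' x y,
  [/\ a = d * a', b = d * b' & x * a' + y * b' = 1].
Proof.
have [x [y [z [w]]]] := hEDD a b 0; set d := (X in is_gcd3 X).
move=> [[a' ea] [b' eb] _ _]; have [d0|dn0] := eqVneq d 0.
  by exists 0, 1, 0, 1, 0; rewrite ea eb d0 !mul0r; split=> //; ring.
exists d, a', b', (z * x), (z * y); split=> //; apply: (mulfI dn0).
by rewrite {2}/d mulrDr (mulrCA d) (mulrCA d _ b') -ea -eb; ring.
Qed.

(** The Bezout gcd [e] is a common divisor, hence divides [d]. Multiplying its identity by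
    [l = d / e] expresses [d] as a combination of [a] and [b], and [d] cancels. *)
Lemma is_gcd_comaximal d a b a' b' :
  is_gcd d a b -> d != 0 -> a = d * a' -> b = d * b' -> comaximal a' b'.
Proof.
move=> [_ _ dmin] dn0 ea eb; have [e [a1 [b1 [x [y [ea1 eb1 e1]]]]]] := EDD_gcd a b.
have [l el] : divides e d by apply: dmin; [exists a1 | exists b1].
exists (l * x), (l * y); apply: (mulfI dn0).
have -> : d * (l * x * a' + l * y * b') = l * (x * (d * a') + y * (d * b')) by ring.
rewrite -ea -eb ea1 eb1 el mulr1.
have -> : l * (x * (e * a1) + y * (e * b1)) = e * l * (x * a1 + y * b1) by ring.
by rewrite e1 mulr1.
Qed.

End Divisibility.

(** * Rectangular diagonal matrices *)

Section RectangularDiagonal.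
Variable T : nzRingType.
Implicit Types f g : nat -> T.

(** Indexing the diagonal by all of [nat] makes padding, reversal and direct sums plain operations
    on [f]; values past the edges of the matrix are ignored. *)
Definition dgmx p m f : 'M[T]_(p, m) := \matrix_(i, j) (f i *+ (i == j :> nat)).

Lemma eq_dgmx p m f g :
  (forall i, (i < p)%N -> (i < m)%N -> f i = g i) -> dgmx p m f = dgmx p m g.
Proof.
move=> fg; apply/matrixP=> i j; rewrite !mxE.
by case: eqP => // ij; rewrite fg // ij.
Qed.

(** An inner dimension [m] smaller than both [p] and [q] truncates the diagonal of the product at
    [m], hence the vanishing condition beyond it. *)
Lemma dgmxM p m q f g :
  (forall i, (m <= i)%N -> (i < p)%N -> (i < q)%N -> f i * g i = 0) ->
  dgmx p m f *m dgmx m q g = dgmx p q (fun i => f i * g i).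
Proof.
move=> fg0; apply/matrixP=> i j; rewrite !mxE.
have [lt_im|le_mi] := ltnP i m.
  rewrite (bigD1 (Ordinal lt_im)) //= !mxE eqxx mulr1n mulrnAr big1 ?addr0 // => k.
  by rewrite -val_eqE /= !mxE eq_sym => /negPf->; rewrite mulr0n mul0r.
rewrite big1 => [|k _]; last first.
  by rewrite !mxE gtn_eqF ?mulr0n ?mul0r // (leq_trans (ltn_ord k)).
by case: eqP => // ij; rewrite fg0 // ij.
Qed.

Lemma dgmx1 n f : (forall i, (i < n)%N -> f i = 1) -> dgmx n n f = 1%:M.
Proof.
move=> f1; apply/matrixP=> i j; rewrite !mxE f1 //.
Qed.

Lemma dgmxD p m f g : dgmx p m f + dgmx p m g = dgmx p m (fun i => f i + g i).
Proof. by apply/matrixP=> i j; rewrite !mxE mulrnDl. Qed.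

Lemma dgmxZ p m a f : a *: dgmx p m f = dgmx p m (fun i => a * f i).
Proof. by apply/matrixP=> i j; rewrite !mxE mulrnAr. Qed.

(** The first block is square so that the diagonal of the second continues the main diagonal. *)
Lemma block_dgmx p1 p2 m f1 f2 :
  block_mx (dgmx p1 p1 f1) 0 0 (dgmx p2 m f2) =
  dgmx (p1 + p2) (p1 + m) (fun i => if (i < p1)%N then f1 i else f2 (i - p1)%N).
Proof.
apply/matrixP=> i j; rewrite -[i]splitK -[j]splitK.
case: (split i) => i'; case: (split j) => j' /=; rewrite ?block_mxEul
  ?block_mxEur ?block_mxEdl ?block_mxEdr !mxE /=.
- by rewrite ltn_ord.
- by rewrite ltn_eqF // (leq_trans (ltn_ord i')) // leq_addr.
- by rewrite gtn_eqF // (leq_trans (ltn_ord j')) // leq_addr.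
- by rewrite ltnNge leq_addr addKn eqn_add2l.
Qed.

End RectangularDiagonal.

Lemma map_dgmx (T T' : nzRingType) (h : {rmorphism T -> T'}) p m f :
  map_mx h (dgmx p m f) = dgmx p m (fun i => h (f i)).
Proof. by apply/matrixP=> i j; rewrite !mxE rmorphMn. Qed.

Lemma dgmx_unit (T : comUnitRingType) n (f : nat -> T) :
  (forall i, (i < n)%N -> f i \is a GRing.unit) -> dgmx n n f \in unitmx.
Proof.
move=> uf; have /mulmx1_unit[] // : dgmx n n f *m dgmx n n (fun i => (f i)^-1) = 1%:M.
rewrite dgmxM => [|i le_ni lt_in]; last by rewrite ltnNge le_ni in lt_in.
by apply: dgmx1 => i /uf/mulrV.
Qed.

(** The matrix is the partial identity of rank [r] times an invertible diagonal matrix, in which the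
    zeros of [f] are replaced by 1. *)
Lemma mxrank_dgmx (K : fieldType) p m r (f : nat -> K) :
    (r <= p)%N -> (r <= m)%N ->
    (forall i, (i < r)%N -> f i != 0) -> (forall i, (r <= i)%N -> f i = 0) ->
  \rank (dgmx p m f) = r.
Proof.
move=> le_rp le_rm f_neq0 f0.
pose f' i := if (i < r)%N then f i else 1.
have -> : dgmx p m f = dgmx p m (fun i => (i < r)%:R) *m dgmx m m f'.
  rewrite dgmxM => [|i le_mi _]; last by rewrite ltnNge le_mi.
  apply: eq_dgmx => i _ _; rewrite /f'; case: ltnP => [|/f0->]; first by rewrite mul1r.
  by rewrite mul0r.
rewrite mxrankMfree; last first.
  rewrite row_free_unit dgmx_unit // => i _; rewrite unitfE /f'.
  by case: ifP => [/f_neq0|]; rewrite ?oner_eq0.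
rewrite -[RHS](rank_pid_mx K le_rp le_rm); congr mxrank.
by apply/matrixP=> i j; rewrite !mxE -mulrnA mulnb andbC.
Qed.

(** * Unimodular equivalence over a commutative ring *)

Section Equivalence.
Variable R : comUnitRingType.

Definition requiv p m (M N : 'M[R]_(p, m)) : Prop :=
  exists (U : 'M[R]_p) (V : 'M[R]_m),
    [/\ U \in unitmx, V \in unitmx & U *m M *m V = N].

Lemma requiv_refl p m (M : 'M[R]_(p, m)) : requiv M M.
Proof. by exists 1%:M, 1%:M; rewrite !unitmx1 mul1mx mulmx1. Qed.

Lemma requiv_sym p m (M N : 'M[R]_(p, m)) : requiv M N -> requiv N M.
Proof.
move=> [U [V [uU uV <-]]]; exists (invmx U), (invmx V).
by rewrite !unitmx_inv; split=> //; rewrite -!mulmxA mulKmx // mulmxV ?mulmx1.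
Qed.

Lemma requiv_trans p m (N M P : 'M[R]_(p, m)) :
  requiv M N -> requiv N P -> requiv M P.
Proof.
move=> [U [V [uU uV <-]]] [U' [V' [uU' uV' <-]]]; exists (U' *m U), (V *m V').
by rewrite !unitmx_mul uU uV uU' uV' !mulmxA.
Qed.

Lemma requivMl p m (U : 'M[R]_p) (M : 'M_(p, m)) : U \in unitmx -> requiv M (U *m M).
Proof. by move=> uU; exists U, 1%:M; rewrite unitmx1 mulmx1. Qed.

Lemma requivMr p m (V : 'M[R]_m) (M : 'M_(p, m)) : V \in unitmx -> requiv M (M *m V).
Proof. by move=> uV; exists 1%:M, V; rewrite unitmx1 mul1mx. Qed.

Lemma requivZ p m (k : R) (M N : 'M[R]_(p, m)) :
  requiv M N -> requiv (k *: M) (k *: N).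
Proof.
move=> [U [V [uU uV <-]]]; exists U, V.
by rewrite -scalemxAr -scalemxAl.
Qed.

Lemma requiv_block p1 p2 m1 m2 (M1 N1 : 'M[R]_(p1, m1)) (M2 N2 : 'M[R]_(p2, m2)) :
  requiv M1 N1 -> requiv M2 N2 ->
  requiv (block_mx M1 0 0 M2) (block_mx N1 0 0 N2).
Proof.
move=> [U [V [uU uV <-]]] [U' [V' [uU' uV' <-]]].
exists (block_mx U 0 0 U'), (block_mx V 0 0 V').
rewrite !block_diag_mx_unit uU uV uU' uV'; split=> //.
by rewrite !mulmx_block !(mul0mx, mulmx0, addr0, add0r).
Qed.

Lemma block1l_unit p m (J : 'M[R]_(p, m)) : block_mx 1%:M 0 J 1%:M \in unitmx.
Proof.
have /mulmx1_unit[] // : block_mx 1%:M 0 J 1%:M *m block_mx 1%:M 0 (- J) 1%:M = 1%:M.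
rewrite mulmx_block !(mul0mx, mulmx0, mul1mx, mulmx1, addr0, add0r) subrr.
by rewrite -scalar_mx_block.
Qed.

Lemma block1r_unit p m (J : 'M[R]_(p, m)) : block_mx 1%:M J 0 1%:M \in unitmx.
Proof. by rewrite -unitmx_tr tr_block_mx !trmx1 trmx0 block1l_unit. Qed.

Lemma requiv_block_elim k p m (u : 'M[R]_k) r c (N : 'M[R]_(p, m)) :
  u \in unitmx ->
  requiv (block_mx u r c N) (block_mx u 0 0 (N - c *m invmx u *m r)).
Proof.
move=> uu; exists (block_mx 1%:M 0 (- (c *m invmx u)) 1%:M).
exists (block_mx 1%:M (- (invmx u *m r)) 0 1%:M).
rewrite block1l_unit block1r_unit; split=> //.
rewrite !mulmx_block !(mul0mx, mulmx0, mul1mx, mulmx1, addr0, add0r).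
rewrite mulmxN mulKVmx // addNr mulNmx mulmxKV // addNr mul0mx add0r.
by rewrite mulNmx [X in block_mx _ _ _ X]addrC.
Qed.

(** Conjugation by the order-reversing permutation. It turns the decreasing divisibility chain of
    denominators into the increasing one of a Smith form. *)
Lemma requiv_rev n (f : nat -> R) :
  requiv (dgmx n n f) (dgmx n n (fun i => f (n - i.+1)%N)).
Proof.
pose s : 'S_n := perm (@rev_ord_inj n).
exists (perm_mx s), (perm_mx s^-1); rewrite !unitmx_perm; split=> //.
rewrite -row_permE -col_permE; apply/matrixP=> i j; rewrite !mxE !permE.
by congr (f _ *+ nat_of_bool _); rewrite !val_eqE (inj_eq rev_ord_inj).
Qed.

End Equivalence.

(** * Smith forms over an elementary divisor domain, and Bezout identities for matrices *)

Section SmithForm.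
Variable R : idomainType.

Lemma scalemxI p m (d : R) : d != 0 -> injective (fun M : 'M[R]_(p, m) => d *: M).
Proof.
move=> dn0 M N /matrixP MN; apply/matrixP=> i j; apply: (mulfI dn0).
by have := MN i j; rewrite !mxE.
Qed.

Hypothesis hEDD : elementary_divisor_domain R.

(** By induction the tail of [r] is [k] times the first row of a unimodular matrix. A unimodular
    transformation built from the Bezout identity of the head and [k] merges both into their gcd. *)
Lemma row_hermite m (r : 'rV[R]_(1 + m)) :
  exists (k : R) (W : 'M[R]_(1 + m)), W \in unitmx /\ r = k *: usubmx W.
Proof.
elim: m r => [|m IHm] r.
  exists (r 0 0), 1%:M; rewrite unitmx1; split=> //.
  apply/rowP=> j; rewrite (ord1 j) !mxE.
  by rewrite [lshift _ _]ord1 eqxx mulr1.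
rewrite -[r]hsubmxK (mx11_scalar (lsubmx r)); set a := lsubmx r 0 0.
have [k [W [uW ->]]] := IHm (rsubmx r).
have [d [a' [b' [x [y [-> -> xy1]]]]]] := EDD_gcd hEDD a k.
(* On the first two coordinates [T] has rows [(a', b')] and [(-y, x)], of determinant
   [x a' + y b' = 1]; [T'] is given there by the adjugate. *)
pose T : 'M[R]_(1 + (1 + m)) := block_mx a'%:M (row_mx b'%:M 0)
  (col_mx (- y)%:M 0) (block_mx x%:M 0 0 1%:M).
pose T' : 'M[R]_(1 + (1 + m)) := block_mx x%:M (row_mx (- b')%:M 0)
  (col_mx y%:M 0) (block_mx a'%:M 0 0 1%:M).
have /mulmx1_unit[uT _] : T *m T' = 1%:M.
  rewrite !mulmx_block mul_col_row mul_row_block mul_mx_row mul_col_mx.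
  rewrite mul_block_col mul_row_col add_block_mx add_row_mx add_col_mx.
  rewrite !(mulmx0, mul0mx, addr0, add0r, mulmx1) -!scalar_mxM -!raddfD /=.
  rewrite (_ : a' * x + b' * y = 1); last by rewrite -xy1; ring.
  rewrite (_ : - y * - b' + x * a' = 1); last by rewrite -xy1; ring.
  rewrite (_ : a' * - b' + b' * a' = 0); last by ring.
  rewrite (_ : - y * x + x * y = 0); last by ring.
  by rewrite !raddf0 row_mx0 col_mx0 -!scalar_mx_block.
exists d, (T *m block_mx 1%:M 0 0 W); split.
  by rewrite unitmx_mul uT block_diag_mx_unit unitmx1.
rewrite -{2}[W]vsubmxK mulmx_block col_mxKu.
rewrite mul_row_col !(mulmx0, mul0mx, addr0, add0r, mulmx1).
by rewrite scale_row_mx mul_scalar_mx scalerA scale_scalar_mx.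
Qed.

(* Kaplansky's reduction: the bilinear form [u M v] attains the gcd [d] of the
   entries of [M].  Writing [M] as a row [r] above [M1], with [d1] attained by
   [M1] at [u1, v1], one looks for [v] of the form [y v1 + x v2], where [v2] is
   in the kernel of [u1 M1 / d1] and attains there the gcd [a] of [r].  The form
   then takes the value [z x a + z y b + w y d1] with [b := r v1]. *)
Lemma EDD_attains_gcd p m (M : 'M[R]_(1 + p, 1 + m)) :
  exists (d : R) (M' : 'M_(1 + p, 1 + m)) (u : 'rV_(1 + p)) (v : 'cV_(1 + m)),
    M = d *: M' /\ u *m M' *m v = 1%:M.
Proof.
(* Here [r'] is the first row of a unimodular matrix and [v] the first column of its inverse. *)
have rowP (r : 'rV[R]_(1 + m)) : exists (d : R) (r' : 'rV_(1 + m)) (v : 'cV_(1 + m)),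
    r = d *: r' /\ r' *m v = 1%:M.
  have [k [W [uW ->]]] := row_hermite r.
  exists k, (usubmx W), (lsubmx (invmx W)); split=> //.
  have := mulmxV uW; rewrite -[W in W *m _]vsubmxK -[invmx W]hsubmxK mul_col_row.
  by rewrite row_mxKl scalar_mx_block => /eq_block_mx[].
elim: p M => [|p IHp] M.
  have [k [r' [v [-> r'v]]]] := rowP M.
  by exists k, r', 1%:M, v; rewrite mul1mx.
rewrite -[M]vsubmxK; move: (usubmx M) (dsubmx M) => r M1.
have [d1 [M1' [u1 [v1 [eM1 e1]]]]] := IHp M1.
pose rho := u1 *m M1'; pose b := (r *m v1) 0 0.
(* The row [r - b rho] vanishes at [v1], so moving [w0] along [v1] into the kernel of [rho] keeps
   the value [a]; on that kernel [r] and [r - b rho] agree. *)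
have [a [r' [w0 [er0 e0]]]] := rowP (r - b *: rho).
have eb : r *m v1 = b%:M by rewrite [LHS]mx11_scalar.
pose c := (rho *m w0) 0 0; pose v2 := w0 - c *: v1.
have ec : rho *m w0 = c%:M by rewrite [LHS]mx11_scalar.
have rho_v2 : rho *m v2 = 0 by rewrite mulmxBr -scalemxAr e1 ec scalemx1 subrr.
have er : r = a *: r' + b *: rho by rewrite -er0 subrK.
have r_v2 : r *m v2 = a%:M.
  rewrite er mulmxDl -(scalemxAl b) rho_v2 scaler0 addr0 mulmxBr -er0 -scalemxAr.
  rewrite [_ *m v1]mulmxBl eb -scalemxAl e1 scalemx1 subrr scaler0 subr0.
  by rewrite er0 -scalemxAl e0 scalemx1.
have [x [y [z [w]]]] := hEDD a b d1; set d := (X in is_gcd3 X).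
move=> [[a2 ea] [b2 eb2] [d2 ed1] _].
have -> : r = d *: (a2 *: r' + b2 *: rho) by rewrite scalerDr !scalerA -ea -eb2.
have -> : M1 = d *: (d2 *: M1') by rewrite scalerA -ed1.
rewrite -scale_col_mx; have [->|dn0] := eqVneq d 0.
  (* The whole matrix is zero, so [M'] may be any matrix; a matrix unit attains 1. *)
  exists 0, (delta_mx 0 0), (delta_mx 0 0), (delta_mx 0 0).
  rewrite !scale0r !mul_delta_mx; split=> //.
  by apply/matrixP=> i j; rewrite !ord1 !mxE.
exists d, (col_mx (a2 *: r' + b2 *: rho) (d2 *: M1')).
exists (row_mx z%:M (w *: u1)), (x *: v2 + y *: v1); split=> //.
apply: (scalemxI dn0); rewrite /= scalemxAl scalemxAr scale_col_mx.
rewrite scalerDr !scalerA -ea -eb2 -ed1 -er -eM1 mul_row_col mulmxDl.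
rewrite mul_scalar_mx -!scalemxAl mulmxDr -!scalemxAr r_v2 eb eM1.
rewrite -scalemxAr -scalemxAl mulmxDr -!scalemxAr -/rho rho_v2 e1.
rewrite scaler0 add0r !scale_scalar_mx -raddfD scale_scalar_mx -raddfD /=.
by congr _%:M; rewrite /d; ring.
Qed.

(** Completing [u] and [v] to unimodular matrices makes the corner of the transformed [M'] a unit,
    because [u M' v = 1]. It serves as pivot and the induction continues on its Schur complement.
    The gcd [d], factored out beforehand, divides all later entries. *)
Lemma smith_exists p m (M : 'M[R]_(p, m)) : exists f : nat -> R,
  (forall i, divides (f i) (f i.+1)) /\ requiv M (dgmx p m f).
Proof.
elim: p m M => [|p IHp] [|m] M; try by exists (fun=> 0); split=> [_|];
  [exact: divides_refl | rewrite ?(flatmx0 M) ?(thinmx0 M);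
     rewrite ?(flatmx0 (dgmx _ _ _)) ?(thinmx0 (dgmx _ _ _)); exact: requiv_refl].
rewrite -[p.+1]/(1 + p)%N -[m.+1]/(1 + m)%N in M *.
have [d [M' [u [v [-> uM'v]]]]] := EDD_attains_gcd M.
have [k [U [uU eu]]] := row_hermite u.
have [l [V [uV ev]]] := row_hermite v^T.
pose N := U *m M' *m V^T; pose w := ulsubmx N.
have uw : w \in unitmx.
  have /mulmx1_unit[] // : w *m (k * l)%:M = 1%:M.
  rewrite -uM'v -[v]trmxK ev eu linearZ /= -!scalemxAl -scalemxAr scalerA.
  by rewrite mul_mx_scalar trmx_usub mul_usub_mx mulmx_lsub mul_usub_mx.
have MN : requiv M' N by exists U, V^T; rewrite unitmx_tr.
pose N' := drsubmx N - dlsubmx N *m invmx w *m ursubmx N.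
have {MN} MN' : requiv M' (block_mx w 0 0 N').
  by apply: requiv_trans MN _; rewrite -[N in requiv N]submxK; apply: requiv_block_elim.
have [f [fS N'f]] := IHp _ N'.
pose f' i := d * (if (i < 1)%N then w 0 0 else f (i - 1)%N).
have uw00 : w 0 0 \is a GRing.unit by rewrite unitmxE det_mx11 in uw.
exists f'; split=> [[|i]|].
- by rewrite /f' /=; apply: divides_mul; [exact: divides_refl | exact: unit_divides].
- rewrite /f' /= !subSS !subn0; apply: divides_mul; [exact: divides_refl | exact: fS].
rewrite -dgmxZ; apply/requivZ/(requiv_trans MN'); rewrite -block_dgmx.
have <- : w = dgmx 1 1 (fun=> w 0 0).
  by apply/matrixP=> i j; rewrite !ord1 !mxE.
by apply: requiv_block => //; apply: requiv_refl.
Qed.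

(* [U] carries the first form to the second up to a right factor.  By pigeonhole
   every permutation [s] has some [i >= k] with [s i <= k], and
   [h k] divides [f k * U i (s i)]; so [h k] divides [f k * \det U]. *)
Lemma smith_unique n (f h : nat -> R) :
    (forall i, divides (f i) (f i.+1)) -> (forall i, divides (h i) (h i.+1)) ->
    requiv (dgmx n n f) (dgmx n n h) ->
  forall k, (k < n)%N -> divides (h k) (f k).
Proof.
move=> fS hS [U [V [uU uV]]] /(congr1 (mulmx^~ (invmx V))); rewrite mulmxK // => UfhV.
move=> k lt_kn; pose K := Ordinal lt_kn.
(* Entry [(i, j)] of the equation reads [U_ij f_j = h_i (V^-1)_ij], where [f_j] divides [f_k] and
   [h_k] divides [h_i]. *)
have hU (i j : 'I_n) : (k <= i)%N -> (j <= k)%N -> divides (h k) (f k * U i j).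
  move=> le_ki le_jk; have /matrixP/(_ i j) := UfhV; rewrite !mxE.
  rewrite (bigD1 j) //= [X in _ + X]big1 ?addr0 => [|l /negPf nlj]; last first.
    by rewrite !mxE val_eqE nlj mulr0n mulr0.
  rewrite (bigD1 i) //= [X in _ + X]big1 ?addr0 => [|l nli]; last first.
    by rewrite !mxE val_eqE eq_sym (negPf nli) mulr0n mul0r.
  rewrite !mxE !eqxx !mulr1n => UfhVij.
  have [c ->] := divides_chain fS le_jk.
  rewrite mulrAC mulrC mulrA; rewrite mulrC in UfhVij; rewrite -mulrA UfhVij.
  by apply/divides_mull/divides_mulr/divides_chain.
suff : divides (h k) (f k * \det U).
  move: uU; rewrite unitmxE => uU /(divides_mulr (\det U)^-1).
  by rewrite mulrK.
rewrite mulr_sumr; apply: divides_sum => s.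
have [i le_ki le_sik] : exists2 i : 'I_n, (k <= i)%N & (s i <= k)%N.
  case: (pickP (fun i : 'I_n => (k <= i) && (s i <= k))%N) => [i /andP[]|none].
    by exists i.
  have {none} ltks (i : 'I_n) : (k <= i)%N -> (k < s i)%N.
    by move=> le_ki; have /negbT := none i; rewrite le_ki -ltnNge.
  have: s @: [set i : 'I_n | (k <= i)%N] \proper [set i : 'I_n | (k <= i)%N].
    apply/properP; split.
      by apply/subsetP=> _ /imsetP[i + ->]; rewrite !inE => /ltks/ltnW.
    exists K; rewrite ?inE //; apply/negP=> /imsetP[i + eK]; rewrite inE => /ltks.
    by rewrite -eK ltnn.
  by move/proper_card; rewrite card_imset ?ltnn //; exact: perm_inj.
rewrite (bigD1 i) //= mulrCA (mulrA (f k)).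
by apply/divides_mull/divides_mulr/hU.
Qed.

(** The Smith form of the stacked matrix factors it as [H K] with [K] square, so coprimeness makes
    [K] unimodular. Since [m <= p + q], the partial identity [J] has a left inverse, hence so does
    [H K]. *)
Lemma right_coprime_bezout p q m (G1 : 'M[R]_(p, m)) (G2 : 'M[R]_(q, m)) :
    (m <= p + q)%N -> right_coprime G1 G2 ->
  exists (X : 'M_(m, p)) (Y : 'M_(m, q)), X *m G1 + Y *m G2 = 1%:M.
Proof.
move=> le_m cop; have [f [_]] := smith_exists (col_mx G1 G2).
move=> [U [V [uU uV UGV]]]; set J : 'M[R]_(p + q, m) := dgmx _ _ (fun=> 1).
pose H := invmx U *m J; pose K := dgmx m m f *m invmx V.
have eG : col_mx G1 G2 = H *m K.
  rewrite /H /K mulmxA -(mulmxA _ J) dgmxM => [|i le_mi _].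
    rewrite (eq_dgmx (g := f)) => [|i _ _]; last by rewrite mul1r.
    by rewrite -UGV -mulmxA mulKmx // mulmxK.
  by rewrite ltnNge le_mi.
have uK : K \in unitmx.
  by apply: (cop K (usubmx H) (dsubmx H));
    rewrite ?mul_usub_mx ?mul_dsub_mx -eG ?col_mxKu ?col_mxKd.
pose Z := invmx K *m dgmx m (p + q) (fun=> 1) *m U.
exists (lsubmx Z), (rsubmx Z); rewrite -mul_row_col hsubmxK eG /Z /H.
rewrite -!mulmxA (mulmxA U) mulmxV // mul1mx (mulmxA _ J) dgmxM => [|i le_i lt_im].
  by rewrite dgmx1 ?mul1mx ?mulVmx // => i _; rewrite mul1r.
by rewrite ltnNge (leq_trans le_m) in lt_im.
Qed.

Lemma left_coprime_bezout p q n (G1 : 'M[R]_(n, p)) (G2 : 'M[R]_(n, q)) :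
    (n <= p + q)%N -> left_coprime G1 G2 ->
  exists (X : 'M_(p, n)) (Y : 'M_(q, n)), G1 *m X + G2 *m Y = 1%:M.
Proof.
move=> le_n /(right_coprime_bezout le_n)[X [Y e]]; exists X^T, Y^T.
by apply: trmx_inj; rewrite linearD /= !trmx_mul !trmxK trmx1.
Qed.

End SmithForm.

(** * Equivalences derived from a coprime factorization over [R] *)

Section CoprimeRealizations.
Variables (R : comUnitRingType) (n m p : nat).
Variables (a : 'M[R]_n) (b : 'M[R]_(n, m)) (c : 'M[R]_(p, n)) (d : 'M[R]_(p, m)).
Variables (E : 'M[R]_(p, m)) (Psi : 'M[R]_m) (Q : 'M[R]_(n, m)).
Variables (X : 'M[R]_n) (Y : 'M[R]_(m, n)) (L : 'M[R]_(m, p)) (K : 'M[R]_m).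
Hypotheses (bezout_ab : a *m X + b *m Y = 1%:M) (bezout_E : L *m E + K *m Psi = 1%:M).
Hypotheses (eb : b *m Psi = a *m Q) (ed : d *m Psi = c *m Q + E).

(* [[a b]] is a right invertible row with kernel spanned by the left invertible
   column [[-Q; Psi]], so that both extend to mutually inverse matrices. *)
Lemma realization_completion : exists (s : 'M_(m, n)) (t : 'M_m),
  s *m X + t *m Y = 0 /\ t *m Psi = s *m Q + 1%:M.
Proof.
(* The pair [s0, t0] already satisfies the second identity. Subtracting [J [a b]] achieves the
   first, and preserves the second because [a Q = b Psi]. *)
pose s0 := L *m c; pose t0 := L *m d + K; pose J := s0 *m X + t0 *m Y.
exists (s0 - J *m a), (t0 - J *m b); split.
  rewrite !mulmxBl addrACA -opprD -!(mulmxA J) -mulmxDr bezout_ab mulmx1.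
  by rewrite subrr.
rewrite !mulmxBl -!(mulmxA J) eb mulmxDl -!mulmxA ed mulmxDr.
rewrite -(addrA (L *m (c *m Q))) bezout_E.
by rewrite addrAC.
Qed.

(** The unimodular matrix [[t s; b a]] carries [[Psi 0; -Q 1]] to [[1 s; 0 a]]; the off-diagonal
    blocks are then cleared by the identity blocks. *)
Lemma realization_state_equiv :
  requiv (block_mx 1%:M 0 0 a : 'M_(m + n)) (block_mx Psi 0 0 1%:M).
Proof.
have [s [t [sX tPsi]]] := realization_completion.
have /mulmx1_unit[uW _] :
    block_mx t s b a *m block_mx Psi Y (- Q) X = 1%:M :> 'M_(m + n).
  rewrite mulmx_block !mulmxN [t *m Y + _]addrC [b *m Y + _]addrC.
  by rewrite sX bezout_ab tPsi eb addrC addKr subrr -scalar_mx_block.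
apply: (@requiv_trans _ _ _ (block_mx 1%:M s 0 a)).
  have := requiv_block_elim (p := n) s 0 a (unitmx1 R m).
  by rewrite invmx1 !mul0mx subr0 => /requiv_sym.
apply: (@requiv_trans _ _ _ (block_mx Psi 0 (- Q) 1%:M)).
  apply: requiv_sym.
  suff -> : block_mx 1%:M s 0 a = block_mx t s b a *m block_mx Psi 0 (- Q) 1%:M.
    exact: requivMl.
  by rewrite mulmx_block !mulmx0 !mulmx1 !mulmxN tPsi eb !add0r addrC addKr subrr.
suff -> : block_mx Psi 0 (- Q) 1%:M
    = block_mx Psi 0 0 1%:M *m block_mx 1%:M 0 (- Q) 1%:M :> 'M_(m + n).
  by apply/requiv_sym/requivMr/block1l_unit.
by rewrite mulmx_block !(mulmx0, mul0mx, mulmx1, mul1mx, addr0, add0r).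
Qed.

(** Right multiplication by the unimodular [[X -Q; Y Psi]] gives [[1 0; cX+dY E]], whose lower left
    block is cleared by the identity. *)
Lemma realization_system_equiv :
  requiv (block_mx a b c d) (block_mx 1%:M 0 0 E).
Proof.
have [s [t [sX tPsi]]] := realization_completion.
have /mulmx1_unit[_ uZ] : block_mx a b s t *m block_mx X (- Q) Y Psi = 1%:M.
  rewrite mulmx_block !mulmxN sX bezout_ab tPsi eb addKr.
  by rewrite addNr -scalar_mx_block.
apply: requiv_trans (requivMr _ uZ) _.
rewrite mulmx_block !mulmxN bezout_ab eb ed addNr addKr.
have := requiv_block_elim (p := p) (0 : 'M_(n, m)) (c *m X + d *m Y) E (unitmx1 R n).
by rewrite mulmx0 subr0.
Qed.

End CoprimeRealizations.

(** * Equivalence over [R] of matrices over a field containing [R] *)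

Section FractionMatrices.
Variables (R : idomainType) (K : fieldType) (phi : {rmorphism R -> K}).
Hypothesis phi_inj : injective phi.
Local Notation "M ^phi" := (map_mx phi M) (at level 1, format "M ^phi").

Lemma phi_mx_inj p m : injective (fun M : 'M[R]_(p, m) => M^phi).
Proof.
move=> M N /matrixP MN; apply/matrixP=> i j.
by have := MN i j; rewrite !mxE => /phi_inj.
Qed.

Lemma phi_mx_unit n (M : 'M[R]_n) : M \in unitmx -> M^phi \in unitmx.
Proof.
move=> uM; have /mulmx1_unit[] // : M^phi *m (invmx M)^phi = 1%:M.
by rewrite -map_mxM mulmxV // map_mx1.
Qed.

(** Convertible to [mx_equiv] when [phi] is [tofrac]. *)
Definition kequiv p m (M N : 'M[K]_(p, m)) : Prop :=
  exists (U : 'M[R]_p) (V : 'M[R]_m),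
    [/\ U \in unitmx, V \in unitmx & U^phi *m M *m V^phi = N].

Lemma kequivZ p m k (M N : 'M[K]_(p, m)) : kequiv M N -> kequiv (k *: M) (k *: N).
Proof.
by move=> [U [V [uU uV <-]]]; exists U, V; rewrite -scalemxAr -scalemxAl.
Qed.

Lemma requiv_kequiv p m (M N : 'M[R]_(p, m)) : requiv M N -> kequiv M^phi N^phi.
Proof. by move=> [U [V [uU uV <-]]]; exists U, V; rewrite !map_mxM. Qed.

Lemma kequiv_rank p m (M N : 'M[K]_(p, m)) : kequiv M N -> \rank M = \rank N.
Proof.
move=> [U [V [uU uV <-]]].
rewrite mxrankMfree ?row_free_unit ?phi_mx_unit //.
by rewrite eqmxMfull // row_full_unit phi_mx_unit.
Qed.

(* Rosenbrock's theorem: [E] and [Psi] are the numerator and the denominator of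
   a coprime factorization of the Schur complement of [a]. *)
Lemma coprime_schur_equiv n m p (a : 'M[R]_n) (b : 'M[R]_(n, m)) (c : 'M[R]_(p, n))
    (d : 'M[R]_(p, m)) X Y X' Y' E Psi L N (S : 'M[K]_(p, m)) :
    a^phi \in unitmx ->
    a *m X + b *m Y = 1%:M -> X' *m a + Y' *m c = 1%:M ->
    kequiv (d^phi - c^phi *m invmx a^phi *m b^phi) S ->
    S *m Psi^phi = E^phi -> L *m E + N *m Psi = 1%:M ->
  requiv (block_mx 1%:M 0 0 a) (block_mx Psi 0 0 1%:M : 'M_(m + n)) /\
  requiv (block_mx a b c d) (block_mx 1%:M 0 0 E).
Proof.
move=> ua abXY acXY [U [V [uU uV eS]]] SPsi EPsi.
(* Absorbing [U] and [V] turns the Schur complement into [S] and leaves [a] unchanged. *)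
pose b' := b *m V; pose c' := U *m c; pose d' := U *m d *m V.
(* Applying [X' a + Y' c = 1] to [q = a^-1 b' Psi] shows that [q] has entries in [R], since [a q]
   and [c' q] do; [Q] is the resulting expression. *)
pose Q := X' *m (b' *m Psi) + Y' *m invmx U *m (d' *m Psi - E).
pose q := invmx a^phi *m (b' *m Psi)^phi.
have cq : c'^phi *m q = (d' *m Psi - E)^phi.
  rewrite map_mxB -SPsi -eS /q /c' /d' /b' !map_mxM mulmxBr mulmxBl mulmxBl.
  by rewrite opprB addrC subrK !mulmxA.
have aq : a^phi *m q = (b' *m Psi)^phi by rewrite mulKVmx.
clearbody q; have eQ : Q^phi = q.
  rewrite map_mxD (map_mxM _ X') (map_mxM _ (Y' *m _)) -aq -cq !mulmxA -mulmxDl.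
  by rewrite -!map_mxM -map_mxD /c' !mulmxA mulmxKV // acXY map_mx1 mul1mx.
have eb : b' *m Psi = a *m Q by apply: phi_mx_inj; rewrite /= (map_mxM _ a) eQ aq.
have ed : d' *m Psi = c' *m Q + E.
  by apply/(canRL (subrK _))/phi_mx_inj; rewrite /= (map_mxM _ c') eQ cq.
have abXY' : a *m X + b' *m (invmx V *m Y) = 1%:M by rewrite -abXY !mulmxA mulmxK.
split; first exact: realization_state_equiv abXY' EPsi eb ed.
apply: requiv_trans (realization_system_equiv abXY' EPsi eb ed).
exists (block_mx 1%:M 0 0 U), (block_mx 1%:M 0 0 V).
rewrite !block_diag_mx_unit !unitmx1; split=> //.
by rewrite !mulmx_block !(mulmx0, mul0mx, mulmx1, mul1mx, addr0, add0r).
Qed.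

End FractionMatrices.

(** * Entrywise choice of Bezout coefficients and of units *)

Lemma comaximal_choice (R : idomainType) (e f : nat -> R) :
    (forall i, comaximal (e i) (f i)) ->
  exists x y : nat -> R, forall i, x i * e i + y i * f i = 1.
Proof.
move=> cop; have ex i : exists z : R * R, z.1 * e i + z.2 * f i == 1.
  by have [x [y xy1]] := cop i; exists (x, y); rewrite xy1.
exists (fun i => (xchoose (ex i)).1), (fun i => (xchoose (ex i)).2) => i.
exact: eqP (xchooseP (ex i)).
Qed.

Lemma requiv_dgmx_assoc (R : idomainType) n (f h : nat -> R) :
    (forall i, (i < n)%N -> divides (f i) (h i) /\ divides (h i) (f i)) ->
  requiv (dgmx n n f) (dgmx n n h).
Proof.
move=> fh; have ex i : exists u : R,
    (u \is a GRing.unit) && ((i < n)%N ==> (h i == f i * u)).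
  have [/fh[fi hi]|_] := boolP (i < n)%N; last by exists 1; rewrite unitr1.
  by have [u uu ->] := divides_assoc fi hi; exists u; rewrite uu eqxx.
pose u i := xchoose (ex i).
have uu i : u i \is a GRing.unit by have /andP[] := xchooseP (ex i).
have hu i : (i < n)%N -> h i = f i * u i.
  by move=> lt_in; have /andP[_ /implyP/(_ lt_in)/eqP] := xchooseP (ex i).
have -> : dgmx n n h = dgmx n n f *m dgmx n n u.
  rewrite dgmxM => [|i le_ni lt_in]; last by rewrite ltnNge le_ni in lt_in.
  by apply: eq_dgmx => i /hu.
by apply/requivMr/dgmx_unit.
Qed.

(** * Smith forms of [a] and of the block matrix from that of the Schur complement *)

Section SchurComplementSmithForm.
Variables (R : idomainType) (K : fieldType) (phi : {rmorphism R -> K}).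
Hypothesis phi_inj : injective phi.
Hypothesis hEDD : elementary_divisor_domain R.
Local Notation "M ^phi" := (map_mx phi M) (at level 1, format "M ^phi").

(** Padding the Smith form of [a] with [m] ones and reversing [q] give two Smith forms of one matrix
    of size [m + n]. Uniqueness matches them entry by entry, which cancels the identity blocks. *)
Lemma smith_denominators n m g (a : 'M[R]_n) (q : nat -> R) :
    (g <= m)%N -> (forall i, (m < i)%N -> q i = 1) ->
    (forall i j, (1 <= i)%N -> (i <= j)%N -> divides (q j) (q i)) ->
    (forall i, (g < i)%N -> q i \is a GRing.unit) ->
    ((0 < g)%N -> q g \isn't a GRing.unit) ->
    requiv (block_mx 1%:M 0 0 a)
           (block_mx (dgmx m m (fun i => q i.+1)) 0 0 1%:M : 'M_(m + n)) ->
  (g <= n)%N /\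
  requiv a (dgmx n n (fun i => if (i < n - g)%N then 1 else q (n - i)%N)).
Proof.
move=> le_gm q1 q_dvd q_unit q_g aq.
have [f [fS af]] := smith_exists hEDD a.
pose f1 i := if (i < m)%N then 1 else f (i - m)%N.
(* For [i < m + n] this is [q (m + n - i)]. Truncated subtraction keeps the index at least 1 for
   every [i], so the divisibility chain never breaks. *)
pose h i := q (m + n - i.+1).+1.
have fh : requiv (dgmx (m + n) (m + n) f1) (dgmx (m + n) (m + n) h).
  apply: requiv_trans (requiv_rev _ (fun i => q i.+1)).
  rewrite /f1 -(block_dgmx _ _ _ (fun=> 1)).
  apply: (requiv_trans (N := block_mx 1%:M 0 0 a)).
    by rewrite dgmx1 //; apply: requiv_block (requiv_refl _) (requiv_sym af).
  apply: requiv_trans aq _; rewrite -(@dgmx1 R n (fun=> 1)) // block_dgmx.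
  rewrite (eq_dgmx (g := fun i => q i.+1)); first exact: requiv_refl.
  by move=> i _ _; case: ltnP => // le_mi; rewrite q1.
have f1S i : divides (f1 i) (f1 i.+1).
  rewrite /f1; have [_|le_mi] := ltnP i m; first exact: divides1.
  by rewrite ltnNge ltnW ?ltnS //= subSn.
have hS i : divides (h i) (h i.+1) by apply: q_dvd => //; rewrite ltnS leq_sub2l.
have hf := smith_unique f1S hS fh; have {}fh := smith_unique hS f1S (requiv_sym fh).
have le_gn : (g <= n)%N.
  rewrite leqNgt; apply/negP=> lt_ng.
  have g_gt0 : (0 < g)%N := leq_ltn_trans (leq0n n) lt_ng.
  (* If [n < g], the entry [q g] of [h] faces one of the padding ones, hence is a unit. *)
  have := hf (m + n - g)%N; rewrite /f1 /h.
  have -> : (m + n - (m + n - g).+1).+1 = g by lia.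
  have -> : (m + n - g < m)%N by lia.
  have -> : (m + n - g < m + n)%N by lia.
  by move=> /(_ isT) /divides_unit; rewrite unitr1 (negPf (q_g g_gt0)) => /(_ isT).
split=> //; apply: requiv_trans af _; apply: requiv_dgmx_assoc => i lt_in.
have := conj (hf (m + i)%N) (fh (m + i)%N); rewrite /f1 /h.
rewrite addKn ltn_add2l lt_in [(m + i < m)%N]ltnNge leq_addr /=.
have -> : (m + n - (m + i).+1).+1 = (n - i)%N by lia.
(* For [i < n - g] the index [n - i] exceeds [g], so [q (n - i)] is a unit and may be replaced by
   1. *)
move=> [/(_ isT) qf /(_ isT) fq]; case: ifP => // lt_i.
split; [apply: divides_trans fq _ | exact: divides1].
by apply/unit_divides/q_unit; lia.
Qed.

(** The padding values 0 of [e] and 1 of [q] beyond [r] are comaximal too, so the entrywise Bezout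
    identities assemble into one for the diagonal matrices [E] and [Psi]. *)
Lemma schur_smith_forms n m p r g (a : 'M[R]_n) (b : 'M[R]_(n, m)) (c : 'M[R]_(p, n))
    (d : 'M[R]_(p, m)) X Y X' Y' (e q : nat -> R) :
    (r <= p)%N -> (r <= m)%N -> (g <= r)%N ->
    (forall i, (r < i)%N -> e i = 0) -> (forall i, (r < i)%N -> q i = 1) ->
    (forall i, q i != 0) -> (forall i, comaximal (e i) (q i)) ->
    (forall i j, (1 <= i)%N -> (i <= j)%N -> divides (q j) (q i)) ->
    (forall i, (g < i)%N -> q i \is a GRing.unit) ->
    ((0 < g)%N -> q g \isn't a GRing.unit) ->
    a^phi \in unitmx ->
    a *m X + b *m Y = 1%:M -> X' *m a + Y' *m c = 1%:M ->
    kequiv phi (d^phi - c^phi *m invmx a^phi *m b^phi)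
               (dgmx p m (fun i => phi (e i.+1) / phi (q i.+1))) ->
  [/\ (g <= n)%N,
      requiv a (dgmx n n (fun i => if (i < n - g)%N then 1 else q (n - i)%N)) &
      requiv (block_mx a b c d)
        (dgmx (n + p) (n + m) (fun i => if (i < n)%N then 1 else e (i - n).+1))].
Proof.
move=> le_rp le_rm le_gr e0 q1 q_neq0 cop q_dvd q_unit q_g ua abXY acXY schur.
have [x [y xy1]] := comaximal_choice cop.
pose E := dgmx p m (fun i => e i.+1); pose Psi := dgmx m m (fun i => q i.+1).
have SPsi : dgmx p m (fun i => phi (e i.+1) / phi (q i.+1)) *m Psi^phi = E^phi.
  rewrite !map_dgmx dgmxM => [|i le_mi _]; last by rewrite ltnNge le_mi.
  apply: eq_dgmx => i _ _; rewrite divfK // -(rmorph0 phi).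
  by rewrite (inj_eq phi_inj).
have EPsi : dgmx m p (fun i => x i.+1) *m E + dgmx m m (fun i => y i.+1) *m Psi = 1%:M.
  rewrite !dgmxM => [||i le_pi _ _].
  - by rewrite dgmxD dgmx1 // => i _; apply: xy1.
  - by move=> i le_mi; rewrite ltnNge le_mi.
  - by rewrite e0 ?mulr0 // ltnS (leq_trans le_rp).
have [aq system] := coprime_schur_equiv phi_inj ua abXY acXY schur SPsi EPsi.
have [] := @smith_denominators _ _ g a q (leq_trans le_gr le_rm) _ q_dvd q_unit q_g aq.
  by move=> i /(leq_ltn_trans le_rm)/q1.
move=> le_gn smith_a; split=> //; apply: requiv_trans system _.
rewrite -(@dgmx1 R n (fun=> 1)) // block_dgmx; exact: requiv_refl.
Qed.

End SchurComplementSmithForm.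

(** * The successive gcds, with [N] standing for the product of [beta] and [gamma] *)

Section GcdCascade.
Variables (R : idomainType) (hEDD : elementary_divisor_domain R).
Variables (alpha N : R) (r : nat) (eps psi : nat -> R).
Hypotheses (alpha_neq0 : alpha != 0) (N_neq0 : N != 0).
Hypothesis epspsi : forall i, (1 <= i <= r)%N ->
  [/\ eps i != 0, psi i != 0 & is_gcd 1 (eps i) (psi i)].
Hypothesis eps_chain : forall i, (1 <= i)%N -> (i < r)%N -> divides (eps i) (eps i.+1).
Hypothesis psi_chain : forall i, (1 <= i)%N -> (i < r)%N -> divides (psi i.+1) (psi i).
Variables delta alphah epst nu betah psit chi alphat betat : nat -> R.
Hypothesis hdelta : forall i, (1 <= i <= r)%N -> is_gcd (delta i) (eps i) alpha.
Hypothesis halphah : forall i, (1 <= i <= r)%N -> alpha = delta i * alphah i.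
Hypothesis hepst : forall i, (1 <= i <= r)%N -> eps i = delta i * epst i.
Hypothesis hnu : forall i, (1 <= i <= r)%N -> is_gcd (nu i) (psi i) N.
Hypothesis hbetah : forall i, (1 <= i <= r)%N -> N = nu i * betah i.
Hypothesis hpsit : forall i, (1 <= i <= r)%N -> psi i = nu i * psit i.
Hypothesis hchi : forall i, (1 <= i <= r)%N -> is_gcd (chi i) (alphah i) (betah i).
Hypothesis halphat : forall i, (1 <= i <= r)%N -> alphah i = chi i * alphat i.
Hypothesis hbetat : forall i, (1 <= i <= r)%N -> betah i = chi i * betat i.

Lemma cascade_neq0 i : (1 <= i <= r)%N ->
  [/\ delta i != 0, nu i != 0, chi i != 0, alphat i != 0 & betat i != 0] /\
  epst i != 0 /\ psit i != 0.
Proof.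
move=> ir; have [] := epspsi ir; move: alpha_neq0 N_neq0.
rewrite {1}(halphah ir) {1}(hbetah ir) (hepst ir) (hpsit ir) (halphat ir) (hbetat ir).
rewrite !mulf_eq0 !negb_or.
by move=> /and3P[-> -> ->] /and3P[-> _ ->] /andP[_ ->] /andP[_ ->].
Qed.

Lemma cascade_alpha i : (1 <= i <= r)%N -> alpha = delta i * chi i * alphat i.
Proof. by move=> ir; rewrite -mulrA -(halphat ir) -(halphah ir). Qed.

Lemma cascade_N i : (1 <= i <= r)%N -> N = nu i * chi i * betat i.
Proof. by move=> ir; rewrite -mulrA -(hbetat ir) -(hbetah ir). Qed.

Lemma comaximal_eps_psi i : (1 <= i <= r)%N -> comaximal (eps i) (psi i).
Proof.
by move=> ir; have [_ _ /is_gcd_comaximal] := epspsi ir; apply;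
  rewrite ?oner_eq0 ?mul1r.
Qed.

Lemma comaximal_epst_alphah i : (1 <= i <= r)%N -> comaximal (epst i) (alphah i).
Proof.
move=> ir; have [[dn0 _ _ _ _] _] := cascade_neq0 ir.
exact: is_gcd_comaximal (hdelta ir) dn0 (hepst ir) (halphah ir).
Qed.

Lemma comaximal_psit_betah i : (1 <= i <= r)%N -> comaximal (psit i) (betah i).
Proof.
move=> ir; have [[_ nn0 _ _ _] _] := cascade_neq0 ir.
exact: is_gcd_comaximal (hnu ir) nn0 (hpsit ir) (hbetah ir).
Qed.

Lemma comaximal_alphat_betat i : (1 <= i <= r)%N -> comaximal (alphat i) (betat i).
Proof.
move=> ir; have [[_ _ cn0 _ _] _] := cascade_neq0 ir.
exact: is_gcd_comaximal (hchi ir) cn0 (halphat ir) (hbetat ir).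
Qed.

Lemma cascade_divides i : (1 <= i <= r)%N ->
  [/\ divides (delta i) (eps i) /\ divides (epst i) (eps i),
      divides (nu i) (psi i) /\ divides (psit i) (psi i),
      divides (chi i) (alphah i) /\ divides (alphat i) (alphah i) &
      divides (chi i) (betah i) /\ divides (betat i) (betah i)].
Proof.
move=> ir; rewrite (hepst ir) (hpsit ir) (halphat ir) (hbetat ir).
by split; split; [exists (epst i) | exact: divides_mull (divides_refl _)
  | exists (psit i) | exact: divides_mull (divides_refl _)
  | exists (alphat i) | exact: divides_mull (divides_refl _)
  | exists (betat i) | exact: divides_mull (divides_refl _)].
Qed.

(** Dividing by [chi], [delta] and [nu] makes [alphat] comaximal to [betat], [epst] to [alphat], and
    [psit] to [betat]; the pair [epst], [psit] inherits comaximality from [eps], [psi]. *)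
Lemma comaximal_numerator_denominator i : (1 <= i <= r)%N ->
  comaximal (betat i * epst i) (alphat i * psit i).
Proof.
move=> ir; have [[_ de] [_ dp] [_ da] [_ db]] := cascade_divides ir.
have rr := divides_refl.
apply: comaximalM; apply: comaximal_sym; apply: comaximalM.
- exact: comaximal_alphat_betat.
- exact/comaximal_sym/(comaximal_dvd (rr _ _) da)/comaximal_epst_alphah.
- exact: comaximal_dvd (rr _ _) db (comaximal_psit_betah ir).
- exact/comaximal_sym/(comaximal_dvd de dp)/comaximal_eps_psi.
Qed.

(** [delta i] divides [eps i], which is comaximal to [psi i], and [chi i] divides [betah i], which
    is comaximal to [psit i]. *)
Lemma is_gcd_psit i : (1 <= i <= r)%N -> is_gcd 1 (psit i) (delta i * chi i).
Proof.
move=> ir; have [[dd _] [_ dp] _ [db _]] := cascade_divides ir.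
apply/comaximal_is_gcd/comaximalM.
  exact/comaximal_sym/(comaximal_dvd dd dp)/comaximal_eps_psi.
exact: comaximal_dvd (divides_refl _) db (comaximal_psit_betah ir).
Qed.

Lemma is_gcd_epst i : (1 <= i <= r)%N -> is_gcd 1 (epst i) (nu i * chi i).
Proof.
move=> ir; have [[_ de] [dn _] [dc _] _] := cascade_divides ir.
apply/comaximal_is_gcd/comaximalM.
  exact: comaximal_dvd de dn (comaximal_eps_psi ir).
exact: comaximal_dvd (divides_refl _) dc (comaximal_epst_alphah ir).
Qed.

(** [reduced_fraction_dvd] is applied in turn to [epst / alphah], [psit / betah] and
    [betat / alphat], which represent [eps / alpha], [psi / N] and [betah / alphah]. The last two
    chains follow from those of [alphat] and [betat], as [delta chi alphat = alpha] and
    [nu chi betat = N] do not depend on the index. *)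
Lemma cascade_chain i : (1 <= i)%N -> (i < r)%N ->
  [/\ divides (epst i) (epst i.+1), divides (psit i.+1) (psit i),
      divides (alphat i.+1) (alphat i), divides (delta i * chi i) (delta i.+1 * chi i.+1)
    & divides (nu i.+1 * chi i.+1) (nu i * chi i)].
Proof.
move=> i_gt0 lt_ir; have ir : (1 <= i <= r)%N by rewrite i_gt0 ltnW.
have jr : (1 <= i.+1 <= r)%N by [].
have [[di0 ni0 ci0 ai0 bi0] _] := cascade_neq0 ir.
have [[dj0 nj0 cj0 aj0 bj0] _] := cascade_neq0 jr.
have [x ex] := eps_chain i_gt0 lt_ir; have [y ey] := psi_chain i_gt0 lt_ir.
have [epst_ij alphah_ji] : divides (epst i) (epst i.+1) /\
    divides (alphah i.+1) (alphah i).
  apply: (reduced_fraction_dvd (c := x)); try exact: comaximal_epst_alphah.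
  apply: (mulfI di0); apply: (mulfI dj0).
  transitivity ((delta i.+1 * epst i.+1) * (delta i * alphah i)); first by ring.
  rewrite -(hepst jr) -(halphah ir) ex (hepst ir) (halphah jr); ring.
have [psit_ji betah_ij] : divides (psit i.+1) (psit i) /\
    divides (betah i) (betah i.+1).
  apply: (reduced_fraction_dvd (c := y)); try exact: comaximal_psit_betah.
  apply: (mulfI ni0); apply: (mulfI nj0).
  transitivity ((nu i * psit i) * (nu i.+1 * betah i.+1)); first by ring.
  rewrite -(hpsit ir) -(hbetah jr) ey (hpsit jr) (hbetah ir); ring.
have [[z ez] [w ew]] := (alphah_ji, betah_ij).
have [[b eb] [a ea]] : divides (betat i) (betat i.+1) /\
    divides (alphat i.+1) (alphat i).
  apply: (reduced_fraction_dvd (c := z * w));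
    try by apply/comaximal_sym/comaximal_alphat_betat.
  apply: (mulfI ci0); apply: (mulfI cj0).
  transitivity ((chi i.+1 * betat i.+1) * (chi i * alphat i)); first by ring.
  rewrite -(hbetat jr) -(halphat ir) ew ez (hbetat ir) (halphat jr); ring.
split=> //; first by exists a.
  exists a; apply: (mulIf aj0); rewrite -(cascade_alpha jr) (cascade_alpha ir) ea.
  by ring.
exists b; apply: (mulIf bi0); rewrite -(cascade_N ir) (cascade_N jr) eb.
by ring.
Qed.

(** With [denom], the diagonal entries of [(N / alpha) G] in lowest terms, indexed from 1 and read
    as 0 / 1 out of range. *)
Definition numer i := if (1 <= i <= r)%N then betat i * epst i else 0.
Definition denom i := if (1 <= i <= r)%N then alphat i * psit i else 1.

Lemma comaximal_numer_denom i : comaximal (numer i) (denom i).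
Proof.
rewrite /numer /denom; case: ifP => [/comaximal_numerator_denominator //|_].
exact/comaximal_sym/comaximal1.
Qed.

Lemma denom_dvd i j : (1 <= i)%N -> (i <= j)%N -> divides (denom j) (denom i).
Proof.
move=> i_gt0; elim: j => [|j IHj] le_ij; first by rewrite leqNgt i_gt0 in le_ij.
move: le_ij; rewrite leq_eqVlt => /predU1P[->|]; first exact: divides_refl.
rewrite ltnS => le_ij; apply: divides_trans (IHj le_ij).
have j_gt0 : (1 <= j)%N := leq_trans i_gt0 le_ij.
rewrite /denom /= j_gt0 /=; have [lt_jr|_] := ltnP j r; last exact: divides1.
have [_ pd ad _ _] := cascade_chain j_gt0 lt_jr.
by rewrite ltnW //; apply: divides_mul.
Qed.

Lemma denom_neq0 i : denom i != 0.
Proof.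
rewrite /denom; case: ifP => [ir|_]; last exact: oner_neq0.
by have [[_ _ _ an0 _] [_ pn0]] := cascade_neq0 ir; rewrite mulf_neq0.
Qed.

(** * Diagonal forms of [A] and of the system matrix over the field *)

Section SystemMatrix.
Variables (K : fieldType) (phi : {rmorphism R -> K}).
Hypothesis phi_inj : injective phi.
Variables (n m p g : nat) (A : 'M[K]_n) (B : 'M[K]_(n, m)) (C : 'M[K]_(p, n)).
Variables (D : 'M[K]_(p, m)) (beta gamma : R).
Variables (a : 'M[R]_n) (b : 'M[R]_(n, m)) (c : 'M[R]_(p, n)) (d : 'M[R]_(p, m)).
Hypotheses (eN : N = beta * gamma) (uA : A \in unitmx).
Hypotheses (ea : phi alpha *: A = map_mx phi a) (eb : phi beta *: B = map_mx phi b).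
Hypotheses (ec : phi gamma *: C = map_mx phi c).
Hypothesis ed : (phi N / phi alpha) *: D = map_mx phi d.
Hypotheses (le_rp : (r <= p)%N) (le_rm : (r <= m)%N) (le_gr : (g <= r)%N).
Hypothesis denom_unit : forall i, (g < i)%N -> denom i \is a GRing.unit.
Hypothesis denom_nonunit : (0 < g)%N -> denom g \isn't a GRing.unit.

Let phi_neq0 x : x != 0 -> phi x != 0.
Proof. by rewrite -(inj_eq phi_inj) rmorph0. Qed.

Lemma scaled_schur : map_mx phi d - map_mx phi c *m invmx (map_mx phi a) *m map_mx phi b
  = (phi N / phi alpha) *: (D - C *m invmx A *m B).
Proof.
have an0 := phi_neq0 alpha_neq0.
have uaA : phi alpha *: A \in unitmx by rewrite unitmxZ // unitfE.
rewrite -ea -eb -ec -ed invmxZ // scalerBr; congr (_ - _).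
rewrite -!scalemxAl -!scalemxAr -scalemxAl !scalerA; congr (_ *: _).
by rewrite eN rmorphM; ring.
Qed.

(** Supplies the rank condition of [smith_mcmillan] for the system matrix. *)
Lemma mxrank_system_form :
  \rank (dgmx (n + p) (n + m) (fun i => if (i < n)%N then phi 1 / phi N
          else if (i - n < r)%N then
            phi (epst (i - n).+1) / phi (nu (i - n).+1 * chi (i - n).+1) else 0))
  = (n + r)%N.
Proof.
apply: mxrank_dgmx; rewrite ?leq_add2l // => i lt_i.
  case: ifP => [_|/negbT lt_in]; first by rewrite rmorph1 mul1r invr_eq0 phi_neq0.
  have lt_ir : (i - n < r)%N by rewrite ltn_subLR // leqNgt.
  have ir : (1 <= (i - n).+1 <= r)%N by [].
  rewrite lt_ir; have [[dn0 nn0 cn0 an0' bn0] [en0 pn0]] := cascade_neq0 ir.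
  by rewrite mulf_neq0 // ?invr_eq0 phi_neq0 // mulf_neq0.
have le_ni : (n <= i)%N := leq_trans (leq_addr r n) lt_i.
by rewrite !ifN // -leqNgt // leq_subRL.
Qed.

(** The Smith forms over [R] are divided by [alpha] and [N]. As [alpha = delta chi alphat] and
    [N = nu chi betat], the factors [alphat] and [betat] cancel from [denom] and [numer]. *)
Lemma system_smith_mcmillan X Y X' Y' :
    a *m X + b *m Y = 1%:M -> X' *m a + Y' *m c = 1%:M ->
    kequiv phi (D - C *m invmx A *m B)
      (dgmx p m (fun i => if (i < r)%N then phi (eps i.+1) / phi (psi i.+1) else 0)) ->
  [/\ (g <= n)%N,
      kequiv phi A (dgmx n n (fun i => if (i < n - g)%N then phi 1 / phi alpha
        else phi (psit (n - i)%N) / phi (delta (n - i)%N * chi (n - i)%N))) &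
      kequiv phi ((phi N)^-1 *: block_mx (map_mx phi a) (map_mx phi b)
                                         (map_mx phi c) (map_mx phi d))
        (dgmx (n + p) (n + m) (fun i => if (i < n)%N then phi 1 / phi N
          else if (i - n < r)%N then
            phi (epst (i - n).+1) / phi (nu (i - n).+1 * chi (i - n).+1) else 0))].
Proof.
move=> abXY acXY hG; have an0 := phi_neq0 alpha_neq0.
have ua : map_mx phi a \in unitmx by rewrite -ea unitmxZ // unitfE.
have out i : (r < i)%N -> (1 <= i <= r)%N = false.
  by move=> lt_ri; rewrite [(i <= r)%N]leqNgt lt_ri andbF.
have [|||le_gn smith_a smith_sys] := @schur_smith_forms _ _ _ phi_inj hEDD n m p r g
    a b c d X Y X' Y' numer denom le_rp le_rm le_gr _ _ denom_neq0
    comaximal_numer_denom denom_dvd denom_unit denom_nonunit ua abXY acXY.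
- by move=> i /out ir; rewrite /numer ir.
- by move=> i /out ir; rewrite /denom ir.
- rewrite scaled_schur; have := kequivZ (phi N / phi alpha) hG.
  rewrite dgmxZ; congr kequiv; apply: eq_dgmx => i _ _.
  rewrite /numer /denom /=; case: ltnP => lt_ir; last by rewrite mulr0 rmorph0 mul0r.
  have ir : (1 <= i.+1 <= r)%N by [].
  have [[dn0 nn0 cn0 an0' bn0] [en0 pn0]] := cascade_neq0 ir.
  rewrite {1}(cascade_N ir) {1}(cascade_alpha ir) (hepst ir) (hpsit ir) !rmorphM.
  by field; rewrite ?phi_neq0.
split=> //.
- have := kequivZ (phi alpha)^-1 (requiv_kequiv phi smith_a).
  rewrite -ea scalerA mulVf // scale1r map_dgmx dgmxZ; congr kequiv.
  apply: eq_dgmx => i lt_in _; case: ifP => [_|/negbT lt_i]; first by rewrite mulrC.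
  have ir : (1 <= n - i <= r)%N by lia.
  have [[dn0 nn0 cn0 an0' bn0] [en0 pn0]] := cascade_neq0 ir.
  rewrite /denom ir {1}(cascade_alpha ir) !rmorphM.
  by field; rewrite ?phi_neq0.
have := kequivZ (phi N)^-1 (requiv_kequiv phi smith_sys).
rewrite map_dgmx dgmxZ map_block_mx; congr kequiv.
apply: eq_dgmx => i _ _; case: ifP => [_|_]; first by rewrite mulrC.
rewrite /numer /=; case: ltnP => lt_ir; last by rewrite rmorph0 mulr0.
have ir : (1 <= (i - n).+1 <= r)%N by [].
have [[dn0 nn0 cn0 an0' bn0] [en0 pn0]] := cascade_neq0 ir.
rewrite {1}(cascade_N ir) !rmorphM.
by field; rewrite ?phi_neq0.
Qed.

End SystemMatrix.

End GcdCascade.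

(** * Largest indices and entries of the lists of invariants *)

Lemma det_neq0_unitmx (K : fieldType) n (A : 'M[K]_n) : \det A != 0 -> A \in unitmx.
Proof. by rewrite unitmxE unitfE. Qed.

(** An empty maximum is 0, outside the range, so [0 < g] tells that some index satisfies [P]. *)
Lemma bigmax_nat_cases (P : pred nat) r g :
    g = (\max_(1 <= i < r.+1 | P i) i)%N ->
  [/\ (g <= r)%N, (0 < g)%N -> P g & forall i, (g < i <= r)%N -> ~~ P i].
Proof.
move=> ->; set g' := bigop _ _ _.
have : g' = 0 \/ (1 <= g' <= r)%N && P g'.
  rewrite /g' big_seq_cond; elim/big_ind: _ => [|x y Kx Ky|i]; first by left.
    by rewrite /maxn; case: ifP.
  by rewrite mem_index_iota ltnS; right.
split.
- by case: H => [->|/andP[/andP[]]].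
- by move=> g'0; case: H => [g'E|/andP[]//]; rewrite g'E in g'0.
move=> i /andP[lt_g'i le_ir]; apply/negP=> Pi.
suff : (i <= g')%N by rewrite leqNgt lt_g'i.
apply: leq_bigmax_seq => //; rewrite mem_index_iota ltnS le_ir andbT.
exact: leq_trans lt_g'i.
Qed.

Lemma nth_nseq_cat_rev_iota (T : Type) (x0 x : T) (F : nat -> T) n g i :
    (g <= n)%N -> (i < n)%N ->
  nth x0 (nseq (n - g) x ++ [seq F k | k <- rev (iota 1 g)]) i =
  if (i < n - g)%N then x else F (n - i)%N.
Proof.
move=> le_gn lt_in; rewrite nth_cat size_nseq nth_nseq; case: ltnP => // le_i.
have lt_ig : (i - (n - g) < g)%N by lia.
rewrite (nth_map 0%N) ?size_rev ?size_iota // nth_rev ?size_iota // nth_iota; last by lia.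
by have -> : (1 + (g - (i - (n - g)).+1) = n - i)%N by lia.
Qed.

Lemma nth_nseq_cat_iota (T : Type) (x0 x : T) (F : nat -> T) n r i : (i < n + r)%N ->
  nth x0 (nseq n x ++ [seq F k | k <- iota 1 r]) i =
  if (i < n)%N then x else F (i - n).+1.
Proof.
move=> lt_i; rewrite nth_cat size_nseq nth_nseq; case: ltnP => // le_ni.
by rewrite (nth_map 0%N) ?size_iota ?nth_iota // ltn_subLR.
Qed.

(** * Least common denominators and Bezout identities over the fraction field *)

Section FractionLcd.
Variable R : idomainType.
Local Notation F := {fraction R}.

Lemma tofrac_inj : injective (@tofrac R).
Proof. by move=> x y /eqP; rewrite tofrac_eq => /eqP. Qed.

Lemma diag_oplus0_dgmx p m (s : seq (R * R)) :
  diag_oplus0 p m [seq tofrac x.1 / tofrac x.2 | x <- s] =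
  dgmx p m (fun i => if (i < size s)%N
    then tofrac (nth (0, 1) s i).1 / tofrac (nth (0, 1) s i).2 else 0).
Proof.
apply/matrixP=> i j; rewrite !mxE; case: ltnP => [lt_i|le_i].
  by rewrite (nth_map (0, 1)).
by rewrite nth_default ?size_map.
Qed.

(** Coprimeness over the field provides its own least common denominators. By minimality the given
    one divides them, and the quotient [k] relates the integral matrices. *)
Lemma lcd_scaled_dvd t t' p m (T : 'M[F]_(p, m)) (M M' : 'M[R]_(p, m)) :
    is_lcd t T -> t' != 0 -> tofrac t *: T = mxfrac M -> tofrac t' *: T = mxfrac M' ->
  exists k, M' = k *: M.
Proof.
move=> [_ _ tmin] t'n0 eM eM'; have [|k ek] := tmin t' t'n0; first by exists M'.
exists k; apply: (phi_mx_inj tofrac_inj); rewrite map_mxZ.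
have -> : map_mx (@tofrac R) M = tofrac t *: T by rewrite eM.
have -> : map_mx (@tofrac R) M' = tofrac t' *: T by rewrite eM'.
by rewrite scalerA ek tofracM mulrC.
Qed.

Hypothesis hEDD : elementary_divisor_domain R.

(** The quotients [k1] and [k2] of denominators are absorbed into the Bezout coefficients. *)
Lemma frac_left_coprime_bezout n m (A : 'M[F]_n) (B : 'M[F]_(n, m)) alpha beta a b :
    frac_left_coprime A B -> is_lcd alpha A -> is_lcd beta B ->
    tofrac alpha *: A = mxfrac a -> tofrac beta *: B = mxfrac b ->
  exists X Y, a *m X + b *m Y = 1%:M.
Proof.
move=> [t1 [t2 [G1 [G2 [[t1n0 _ _] [t2n0 _ _] e1 e2 cop]]]]] lcdA lcdB ea eb.
have [k1 ek1] := lcd_scaled_dvd lcdA t1n0 ea e1.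
have [k2 ek2] := lcd_scaled_dvd lcdB t2n0 eb e2.
have [X [Y XY]] := left_coprime_bezout hEDD (leq_addr m n) cop.
by exists (k1 *: X), (k2 *: Y); rewrite -!scalemxAr !scalemxAl -ek1 -ek2.
Qed.

Lemma frac_right_coprime_bezout n p (A : 'M[F]_n) (C : 'M[F]_(p, n)) alpha gamma a c :
    frac_right_coprime A C -> is_lcd alpha A -> is_lcd gamma C ->
    tofrac alpha *: A = mxfrac a -> tofrac gamma *: C = mxfrac c ->
  exists X Y, X *m a + Y *m c = 1%:M.
Proof.
move=> [t1 [t2 [G1 [G2 [[t1n0 _ _] [t2n0 _ _] e1 e2 cop]]]]] lcdA lcdC ea ec.
have [k1 ek1] := lcd_scaled_dvd lcdA t1n0 ea e1.
have [k2 ek2] := lcd_scaled_dvd lcdC t2n0 ec e2.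
have [X [Y XY]] := right_coprime_bezout hEDD (leq_addr p n) cop.
by exists (k1 *: X), (k2 *: Y); rewrite -!scalemxAl !scalemxAr -ek1 -ek2.
Qed.

End FractionLcd.

(** * Rank, coprimeness and divisibility conditions for both Smith-McMillan forms *)

Theorem theorem6p2 (R : idomainType)
  (hEDD : elementary_divisor_domain R) (hnf : not_a_field R)
  (n m p : nat)
  (A : 'M[{fraction R}]_n) (B : 'M[{fraction R}]_(n, m))
  (C : 'M[{fraction R}]_(p, n)) (D : 'M[{fraction R}]_(p, m))
  (hdet : \det A != 0)
  (hAB : frac_left_coprime A B) (hAC : frac_right_coprime A C)
  (alpha beta gamma : R)
  (halpha : is_lcd alpha A) (hbeta : is_lcd beta B) (hgamma : is_lcd gamma C)
  (hD : mx_integral ((tofrac (beta * gamma) / tofrac alpha) *: D))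
  (r : nat) (eps psi : nat -> R)
  (hG : smith_mcmillan (D - C *m invmx A *m B)
          [seq (eps i, psi i) | i <- iota 1 r])
  (delta alphah epst nu betah psit chi alphat betat : nat -> R)
  (hdelta : forall i, (1 <= i <= r)%N -> is_gcd (delta i) (eps i) alpha)
  (halphah : forall i, (1 <= i <= r)%N -> alpha = delta i * alphah i)
  (hepst : forall i, (1 <= i <= r)%N -> eps i = delta i * epst i)
  (hnu : forall i, (1 <= i <= r)%N -> is_gcd (nu i) (psi i) (beta * gamma))
  (hbetah : forall i, (1 <= i <= r)%N -> beta * gamma = nu i * betah i)
  (hpsit : forall i, (1 <= i <= r)%N -> psi i = nu i * psit i)
  (hchi : forall i, (1 <= i <= r)%N -> is_gcd (chi i) (alphah i) (betah i))
  (halphat : forall i, (1 <= i <= r)%N -> alphah i = chi i * alphat i)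
  (hbetat : forall i, (1 <= i <= r)%N -> betah i = chi i * betat i)
  (g : nat)
  (hg : g = (\max_(1 <= i < r.+1 |
               (alphat i * psit i)%R \isn't a GRing.unit) i)%N) :
  [/\ (g <= n)%N,
      smith_mcmillan A
        (nseq (n - g) (1, alpha) ++
         [seq (psit i, delta i * chi i) | i <- rev (iota 1 g)]) &
      smith_mcmillan
        ((tofrac (beta * gamma))^-1 *:
          block_mx (tofrac alpha *: A) (tofrac beta *: B)
                   (tofrac gamma *: C)
                   ((tofrac (beta * gamma) / tofrac alpha) *: D))
        (nseq n (1, beta * gamma) ++
         [seq (epst i, nu i * chi i) | i <- iota 1 r])].
Proof.
have [an0 [a ea] _] := halpha; have [bn0 [b eb] _] := hbeta.
have [cn0 [c ec] _] := hgamma; have [d ed] := hD.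
have Nn0 : beta * gamma != 0 by rewrite mulf_neq0.
have uA := det_neq0_unitmx hdet.
have [X [Y abXY]] := frac_left_coprime_bezout hEDD hAB halpha hbeta ea eb.
have [X' [Y' acXY]] := frac_right_coprime_bezout hEDD hAC halpha hgamma ea ec.
have [sizeG equivG epspsi eps_chain psi_chain] := hG.
rewrite size_map size_iota in sizeG epspsi eps_chain psi_chain.
have le_rp : (r <= p)%N by rewrite sizeG rank_leq_row.
have le_rm : (r <= m)%N by rewrite sizeG rank_leq_col.
(* List positions start at 0, the indices of the statement at 1. *)
have nthG i : (i < r)%N ->
    nth (0, 1) [seq (eps i, psi i) | i <- iota 1 r] i = (eps i.+1, psi i.+1).
  by move=> lt_ir; rewrite (nth_map 0%N) ?size_iota // nth_iota.
have {}epspsi i : (1 <= i <= r)%N ->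
    [/\ eps i != 0, psi i != 0 & is_gcd 1 (eps i) (psi i)].
  by case: i => // i lt_ir; have := epspsi i lt_ir; rewrite nthG.
have {}eps_chain i : (1 <= i)%N -> (i < r)%N -> divides (eps i) (eps i.+1).
  by case: i => // i _ lt_ir; have := eps_chain i lt_ir; rewrite !nthG // ltnW.
have {}psi_chain i : (1 <= i)%N -> (i < r)%N -> divides (psi i.+1) (psi i).
  by case: i => // i _ lt_ir; have := psi_chain i lt_ir; rewrite !nthG // ltnW.
have [le_gr g_nonunit g_unit] := bigmax_nat_cases hg.
have denom_in i : (1 <= i <= r)%N -> denom r psit alphat i = alphat i * psit i.
  by rewrite /denom => ->.
have denom_unit i : (g < i)%N -> denom r psit alphat i \is a GRing.unit.
  move=> lt_gi; rewrite /denom; case: ifP => [/andP[_ le_ir]|_]; last exact: unitr1.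
  by have := g_unit i; rewrite lt_gi le_ir negbK; apply.
have denom_nonunit : (0 < g)%N -> denom r psit alphat g \isn't a GRing.unit.
  by move=> g_gt0; rewrite denom_in ?g_gt0 //; apply: g_nonunit.
have schur : kequiv (@tofrac R) (D - C *m invmx A *m B) (dgmx p m
    (fun i => if (i < r)%N then tofrac (eps i.+1) / tofrac (psi i.+1) else 0)).
  move: equivG; rewrite diag_oplus0_dgmx size_map size_iota.
  congr (mx_equiv _ _); apply: eq_dgmx => i _ _; case: ifP => // lt_ir.
  by rewrite nthG.
have cascade_chain := cascade_chain hEDD an0 Nn0 epspsi eps_chain psi_chain
  hdelta halphah hepst hnu hbetah hpsit hchi halphat hbetat.
have is_gcd_psit := is_gcd_psit hEDD an0 Nn0 epspsi
  halphah hepst hnu hbetah hpsit halphat hbetat.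
have is_gcd_epst := is_gcd_epst hEDD an0 Nn0 epspsi
  hdelta halphah hepst hbetah hpsit halphat hbetat.
have neq0 := cascade_neq0 an0 Nn0 epspsi
  halphah hepst hbetah hpsit halphat hbetat.
have rankP := mxrank_system_form an0 Nn0 epspsi halphah hepst hbetah hpsit halphat hbetat
  (@tofrac_inj R) n le_rp le_rm.
have [le_gn smithA smithP] := system_smith_mcmillan hEDD an0 Nn0 epspsi eps_chain
  psi_chain hdelta halphah hepst hnu hbetah hpsit hchi halphat hbetat (@tofrac_inj R)
  (erefl _) uA ea eb ec ed le_rp le_rm le_gr denom_unit denom_nonunit abXY acXY schur.
split=> //.
  set s := _ ++ _.
  have size_s : size s = n by rewrite size_cat size_nseq size_map size_rev size_iota subnK.
  have nth_s i : (i < n)%N -> nth (0, 1) s i = if (i < n - g)%N then (1, alpha)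
      else (psit (n - i)%N, delta (n - i)%N * chi (n - i)%N).
    exact: (nth_nseq_cat_rev_iota _ _ (fun i => (psit i, delta i * chi i))).
  have range_s i : (i < n)%N -> (n - g <= i)%N -> (1 <= n - i <= r)%N.
    by move=> lt_in le_i; clear -lt_in le_i le_gn le_gr; lia.
  split.
  - by rewrite size_s mxrank_unit.
  - rewrite diag_oplus0_dgmx size_s; move: smithA; congr (mx_equiv _ _).
    by apply: eq_dgmx => i lt_in _; rewrite lt_in nth_s //; case: ifP.
  - rewrite size_s => i lt_in; rewrite nth_s //; case: ltnP => [_|le_i] /=.
      by rewrite oner_eq0 an0; split=> //; apply/comaximal_is_gcd/comaximal1.
    have ir := range_s _ lt_in le_i.
    have [[dn0 _ chin0 _ _] [_ pn0]] := neq0 _ ir.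
    by split; [| rewrite mulf_neq0 | exact: is_gcd_psit].
  - rewrite size_s => i lt_in; rewrite !nth_s ?(ltnW lt_in) //.
    case: (ltnP i (n - g)) => [_|le_i]; first exact: divides1.
    (* The list runs backwards: positions [i] and [i.+1] hold the indices [j.+1] and [j] for
       [j = n - i.+1]. *)
    have /andP[j_gt0 lt_jr] := range_s _ lt_in (leqW le_i).
    have := range_s i (ltnW lt_in) le_i.
    have -> : (i.+1 < n - g)%N = false by rewrite ltnNge leqW.
    rewrite /= -(subnSK (ltnW lt_in)) => /andP[_ lt_jr'].
    by have [_ ? _ _ _] := cascade_chain _ j_gt0 lt_jr'.
  rewrite size_s => i lt_in; rewrite !nth_s ?(ltnW lt_in) //.
  case: (ltnP i.+1 (n - g)) => [lt_i|le_i]; first by rewrite ltnW //; apply: divides_refl.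
  have ir := range_s _ lt_in le_i.
  case: ltnP => [_|lt_i] /=.
    (* At the junction of the two parts, [delta chi] at index [g] has to divide [alpha]. *)
    rewrite [X in divides _ X](cascade_alpha halphah halphat ir).
    exact: divides_mulr (divides_refl _).
  have /andP[j_gt0 lt_jr] := ir.
  have := range_s i (ltnW lt_in) lt_i; rewrite -(subnSK (ltnW lt_in)) => /andP[_ lt_jr'].
  by have [_ _ _ ? _] := cascade_chain _ j_gt0 lt_jr'.
set s := _ ++ _.
have size_s : size s = (n + r)%N by rewrite size_cat size_nseq size_map size_iota.
have nth_s i : (i < n + r)%N -> nth (0, 1) s i = if (i < n)%N then (1, beta * gamma)
    else (epst (i - n).+1, nu (i - n).+1 * chi (i - n).+1).
  exact: (nth_nseq_cat_iota _ _ (fun i => (epst i, nu i * chi i))).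
have range_s i : (i < n + r)%N -> (n <= i)%N -> (1 <= (i - n).+1 <= r)%N.
  by move=> lt_i le_ni; rewrite /= ltn_subLR.
have diag_sP : diag_oplus0 (n + p) (n + m) [seq tofrac x.1 / tofrac x.2 | x <- s] =
    dgmx (n + p) (n + m) (fun i => if (i < n)%N then tofrac 1 / tofrac (beta * gamma)
      else if (i - n < r)%N then
        tofrac (epst (i - n).+1) / tofrac (nu (i - n).+1 * chi (i - n).+1) else 0).
  rewrite diag_oplus0_dgmx size_s; apply: eq_dgmx => i _ _.
  case: (ltnP i n) => [lt_in|le_ni].
    by rewrite (leq_trans lt_in (leq_addr r n)) nth_s ?(leq_trans lt_in (leq_addr r n)) ?lt_in.
  rewrite ltn_subLR //; case: ifP => // lt_i.
  by rewrite nth_s // ltnNge le_ni.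
have equivP : mx_equiv ((tofrac (beta * gamma))^-1 *:
    block_mx (tofrac alpha *: A) (tofrac beta *: B) (tofrac gamma *: C)
      ((tofrac (beta * gamma) / tofrac alpha) *: D))
    (diag_oplus0 (n + p) (n + m) [seq tofrac x.1 / tofrac x.2 | x <- s]).
  by rewrite diag_sP ea eb ec ed.
split=> //.
- rewrite size_s (kequiv_rank (phi := @tofrac R) equivP) -rankP.
  by rewrite diag_sP.
- rewrite size_s => i lt_i; rewrite nth_s //; case: ltnP => [_|le_ni] /=.
    by rewrite oner_eq0 Nn0; split=> //; apply/comaximal_is_gcd/comaximal1.
  have ir := range_s _ lt_i le_ni.
  have [[_ nun0 chin0 _ _] [en0 _]] := neq0 _ ir.
  by split; [| rewrite mulf_neq0 | exact: is_gcd_epst].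
- rewrite size_s => i lt_i; rewrite !nth_s ?(ltnW lt_i) //.
  case: (ltnP i n) => [_|le_ni]; first exact: divides1.
  rewrite (ltnNge i.+1) (leqW le_ni) subSn //=.
  have /andP[_ lt_ir] := range_s _ lt_i (leqW le_ni); rewrite subSn // in lt_ir.
  by have [? _ _ _ _] := cascade_chain (i - n).+1 isT lt_ir.
rewrite size_s => i lt_i; rewrite !nth_s ?(ltnW lt_i) //.
case: (ltnP i.+1 n) => [lt_in|le_ni]; first by rewrite ltnW //; apply: divides_refl.
have ir := range_s _ lt_i le_ni.
case: (ltnP i n) => [_|le_ni'] /=.
  (* At the junction, [nu chi] at index 1 has to divide the product of [beta] and [gamma]. *)
  by rewrite [X in divides _ X](cascade_N hbetah hbetat ir);
    apply: divides_mulr (divides_refl _).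
rewrite subSn // in ir *; case/andP: ir => _ lt_ir.
by have [_ _ _ _ ?] := cascade_chain (i - n).+1 isT lt_ir.
Qed.
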